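(* For a linear relation $R\subseteq\mathbb R^m\times\mathbb R^n$, let $I_R$ be the convex bifunction from $\mathbb R^m$ to $\mathbb R^n$ given by its indicator function, $I_R(x,y)=\{|(x,y)\in R|\}$, and let $-I_R$ be the corresponding concave bifunction. Then $R\mapsto I_R$ and $R\mapsto -I_R$ (identity on objects) define functors \[ I:\mathtt{LinRel}\to\mathtt{CxBiFn},\qquad -I:\mathtt{LinRel}^{\mathrm{op}}\to\mathtt{CvBiFn}^{\mathrm{op}}, \] which commute with the dualities $(-)^*$ on both sides, i.e. for every linear relation $R$, \[ (I_R)^*=-I_{R^*}\quad\text{and}\quad(-I_R)^*=I_{R^*}. \] In addition, the functor $I$ preserves both hypergraph structures $\bullet$ and $\circ$.
   Context: Notation: $\overline{\mathbb R}=[-\infty,+\infty]$; $\langle-,-\rangle$ is the standard inner product; $\{|P|\}$ is $0$ if $P$ holds and $+\infty$ otherwise. A function into $\overline{\mathbb R}$ is convex if its epigraph is convex, concave if its negative is convex. A convex (concave) bifunction from $\mathbb R^m$ to $\mathbb R^n$ is a jointly convex (concave) function $\mathbb R^m\times\mathbb R^n\to\overline{\mathbb R}$. $\mathtt{CxBiFn}$: objects $\mathbb R^n$ ($n\ge0$), morphisms $\mathbb R^m\to\mathbb R^n$ the convex bifunctions, identities $\{|x=y|\}$, composition $(F\circ G)(x,z)=\inf_y\{G(x,y)+F(y,z)\}$. $\mathtt{CvBiFn}$: concave bifunctions, identities $-\{|x=y|\}$, composition $(F\circ G)(x,z)=\sup_y\{G(x,y)+F(y,z)\}$. Addition uses $(+\infty)+(-\infty)=+\infty$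 in $\mathtt{CxBiFn}$ and $=-\infty$ in $\mathtt{CvBiFn}$. Both are symmetric strict monoidal with $\mathbb R^m\otimes\mathbb R^n=\mathbb R^{m+n}$, unit $I=\mathbb R^0=\{\mathbf 0\}$ and $(F\otimes G)((x_1,x_2),(y_1,y_2))=F(x_1,y_1)+G(x_2,y_2)$. Adjoints: for convex $F$ from $\mathbb R^m$ to $\mathbb R^n$, $F^*$ is the concave bifunction from $\mathbb R^n$ to $\mathbb R^m$ with $F^*(y^*,x^* )=\inf_{x,y}\{F(x,y)+\langle x^*,x\rangle-\langle y^*,y\rangle\}$; for concave $F$ from $\mathbb R^m$ to $\mathbb R^n$, $F^*$ is the convex bifunction from $\mathbb R^n$ to $\mathbb R^m$ with the same formula with $\sup$ in place of $\inf$. $\mathtt{LinRel}$: objects $\mathbb R^n$, morphisms $\mathbb R^m\to\mathbb R^n$ the linear relations, i.e. vector subspaces $R\subseteq\mathbb R^m\times\mathbb R^n$, with relational composition and tensor $\mathbb R^m\otimes\mathbb R^n=\mathbb R^{m+n}$ given by product of relations. The duality $(-)^*:\mathtt{LinRel}^{\mathrm{op}}\to\mathtt{LinRel}$ is the contravariant involution composed of converse $R^\dagger=\{(y,x):(x,y)\in R\}$ and twisted orthogonal complement $R^c=\{(x^*,y^* ):\forall(x,y)\in R,\ \langle x^*,x\rangle-\langle y^*,y\rangle=0\}$, i.e. $R^*=(R^c)^\dagger=\{(y^*,x^* ):\forall(x,y)\in R,\ \langle x^*,x\rangle=\langle y^*,y\rangle\}$. A hypergraph category is a symmetric monoidal category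 in which every object carries a special commutative Frobenius algebra structure (compatible with the tensor); a functor preserves the hypergraph structure if it is symmetric monoidal and preserves the four structure maps. The two hypergraph structures on $\mathtt{CxBiFn}$ are: additive ($\bullet$): $\mathrm{unit}(\mathbf 0,x)=0$, $\mathrm{discard}(x,\mathbf 0)=0$, $\mathrm{copy}(x,(y,z))=\{|x=y=z|\}$, $\mathrm{comp}((x,y),z)=\{|x=y=z|\}$; co-additive ($\circ$): $\mathrm{zero}(\mathbf 0,x)=\{|x=0|\}$, $\mathrm{cozero}(x,\mathbf 0)=\{|x=0|\}$, $\mathrm{add}((x,y),z)=\{|x+y=z|\}$, $\mathrm{coadd}(z,(x,y))=\{|x+y=z|\}$. The two hypergraph structures on $\mathtt{LinRel}$ are given by the corresponding linear relations: for $\bullet$, $\{(\mathbf 0,x)\}$ and $\{(x,\mathbf 0)\}$ with $x$ arbitrary, $\{(x,(x,x))\}$, $\{((x,x),x)\}$; for $\circ$, $\{(\mathbf 0,0)\}$, $\{(0,\mathbf 0)\}$, $\{((x,y),x+y)\}$, $\{(x+y,(x,y))\}$. *)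

(* Defs.v *)
From HB Require Import structures.
From mathcomp Require Import all_boot all_order all_algebra.
From mathcomp Require Import all_classical all_reals all_analysis.
From mathcomp Require Import lra.
Set Implicit Arguments.
Unset Strict Implicit.
Unset Printing Implicit Defensive.
Import Order.TTheory GRing.Theory Num.Theory.
Import constructive_ereal.DualAddTheoryNumDomain.
Local Open Scope classical_set_scope.
Local Open Scope ring_scope.

(** Every category below has the spaces R^n as objects, so an object is given
    by n : nat, and the tensor product of objects is addition in nat. A pair
    (x, y) in R^(m+n) is [row_mx x y]. Composition is in the usual order:
    [compose g f] is "g after f". *)
Record category := Category {
  hom : nat -> nat -> Type;
  idm : forall n, hom n n;
  compose : forall m n p, hom n p -> hom m n -> hom m p;
  compose_idl : forall m n (f : hom m n), compose (idm n) f = f;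
  compose_idr : forall m n (f : hom m n), compose f (idm m) = f;
  composeA : forall m n p q (h : hom p q) (g : hom n p) (f : hom m n),
    compose h (compose g f) = compose (compose h g) f }.

Definition opposite (C : category) : category :=
  @Category (fun m n => hom C n m) (idm C)
    (fun m n p g f => compose f g)
    (fun m n f => compose_idr f) (fun m n f => compose_idl f)
    (fun m n p q h g f => esym (composeA f g h)).

(** The functors under consideration are the identity on objects. *)
Definition is_functor (C D : category)
    (F : forall m n, hom C m n -> hom D m n) : Prop :=
  (forall n, F n n (idm C n) = idm D n) /\
  (forall m n p (g : hom C n p) (f : hom C m n),
     F m p (compose g f) = compose (F n p g) (F m n f)).

(** The data of a strict symmetric monoidal structure with R^m (x) R^n =
    R^(m+n) and unit R^0; associators and unitors are identities, so that a
    functor that is the identity on objects has nothing to preserve there. *)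
Record sym_monoidal (C : category) := SymMonoidal {
  tensor : forall m n p q, hom C m n -> hom C p q -> hom C (m + p) (n + q);
  symmetry : forall m n, hom C (m + n) (n + m) }.

(** In this order: unit, discard, copy, comp for the additive structures, and
    zero, cozero, coadd, add for the co-additive ones. *)
Record hypergraph_maps (C : category) := HypergraphMaps {
  hg_unit : forall n, hom C 0 n;
  hg_counit : forall n, hom C n 0;
  hg_comult : forall n, hom C n (n + n);
  hg_mult : forall n, hom C (n + n) n }.

Definition is_sym_monoidal_functor (C D : category)
    (MC : sym_monoidal C) (MD : sym_monoidal D)
    (F : forall m n, hom C m n -> hom D m n) : Prop :=
  [/\ is_functor F,
      forall m n p q (f : hom C m n) (g : hom C p q),
        F _ _ (tensor MC f g) = tensor MD (F _ _ f) (F _ _ g)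
    & forall m n, F _ _ (symmetry MC m n) = symmetry MD m n].

Definition preserves_hypergraph (C D : category)
    (MC : sym_monoidal C) (MD : sym_monoidal D)
    (HC : hypergraph_maps C) (HD : hypergraph_maps D)
    (F : forall m n, hom C m n -> hom D m n) : Prop :=
  is_sym_monoidal_functor MC MD F /\
  forall n, [/\ F _ _ (hg_unit HC n) = hg_unit HD n,
                F _ _ (hg_counit HC n) = hg_counit HD n,
                F _ _ (hg_comult HC n) = hg_comult HD n
              & F _ _ (hg_mult HC n) = hg_mult HD n].

Section Spaces.
Variable R : realType.
Implicit Types m n p q : nat.

Definition dotp n (x y : 'rV[R]_n) : R := \sum_i x 0 i * y 0 i.

Lemma dotpDr n (a b : R) (x u v : 'rV[R]_n) :
  dotp x (a *: u + b *: v) = a * dotp x u + b * dotp x v.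
Proof.
rewrite /dotp !mulr_sumr -big_split; apply: eq_bigr => i _ /=.
by rewrite !mxE mulrDr !mulrA ![x 0 i * _]mulrC.
Qed.

Lemma dotpC n (x y : 'rV[R]_n) : dotp x y = dotp y x.
Proof. by apply: eq_bigr => i _; rewrite mulrC. Qed.

Lemma dotpDl n (a b : R) (x u v : 'rV[R]_n) :
  dotp (a *: u + b *: v) x = a * dotp u x + b * dotp v x.
Proof. by rewrite dotpC dotpDr !(dotpC x). Qed.

Record linrel m n := LinRelation {
  linrel_set :> 'rV[R]_m * 'rV[R]_n -> Prop;
  linrel_submod : submod_closed [in (linrel_set : set _)] }.

Lemma linrel_ext m n (A B : linrel m n) :
  (forall x y, A (x, y) <-> B (x, y)) -> A = B.
Proof.
case: A B => [A HA] [B HB] /= AB.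
have E : A = B by apply/seteqP; split=> -[x y] /AB.
by subst B; congr LinRelation; apply: Prop_irrelevance.
Qed.

Lemma submod_closedP (V : lmodType R) (A : set V) :
  A 0 -> (forall a u v, A u -> A v -> A (a *: u + v)) ->
  submod_closed [in A].
Proof.
move=> A0 AL; split; first by rewrite inE.
by move=> a u v /[!inE]; apply: AL.
Qed.

Lemma linrel0 m n (A : linrel m n) : A (0, 0).
Proof. by have [+ _] := linrel_submod A; rewrite inE. Qed.

Lemma linrelL m n (A : linrel m n) a x y x' y' :
  A (x, y) -> A (x', y') -> A (a *: x + x', a *: y + y').
Proof.
have [_ AL] := linrel_submod A => Axy Axy'.
by have := AL a (x, y) (x', y'); rewrite !inE; apply.
Qed.

Lemma linrelLL m n (A : linrel m n) a b x y x' y' :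
  A (x, y) -> A (x', y') -> A (a *: x + b *: x', a *: y + b *: y').
Proof.
move=> Axy Axy'; apply: linrelL => //.
by rewrite -[b *: x']addr0 -[b *: y']addr0; apply: linrelL; last exact: linrel0.
Qed.

Lemma lr_id_submod n :
  submod_closed [in [set xy : 'rV[R]_n * 'rV[R]_n | xy.1 = xy.2]].
Proof. by apply: submod_closedP => //= a u v -> ->. Qed.
Definition lr_id n : linrel n n := LinRelation (@lr_id_submod n).

Lemma lr_comp_submod m n p (B : linrel n p) (A : linrel m n) :
  submod_closed [in [set xz | exists y, A (xz.1, y) /\ B (y, xz.2)]].
Proof.
apply: submod_closedP => /= [|a u v [y [Ay By]] [y' [Ay' By']]].
  by exists 0; split; apply: linrel0.
by exists (a *: y + y'); split; apply: linrelL.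
Qed.
Definition lr_comp m n p (B : linrel n p) (A : linrel m n) : linrel m p :=
  LinRelation (lr_comp_submod B A).

Lemma lr_comp_idl m n (A : linrel m n) : lr_comp (lr_id n) A = A.
Proof.
by apply: linrel_ext => x y; split => [[z /= [Az <-]]|Axy] //; exists y.
Qed.

Lemma lr_comp_idr m n (A : linrel m n) : lr_comp A (lr_id m) = A.
Proof.
by apply: linrel_ext => x y; split => [[z /= [-> Az]]|Axy] //; exists x.
Qed.

Lemma lr_compA m n p q (C : linrel p q) (B : linrel n p) (A : linrel m n) :
  lr_comp C (lr_comp B A) = lr_comp (lr_comp C B) A.
Proof.
apply: linrel_ext => x y; split => /=.
  by move=> [z [[w [Aw Bw]] Cz]]; exists w; split => //; exists z.
by move=> [z [Az [w [Bw Cw]]]]; exists w; split => //; exists z.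
Qed.

Definition LinRel : category :=
  Category lr_comp_idl lr_comp_idr lr_compA.

Lemma lr_converse_submod m n (A : linrel m n) :
  submod_closed [in [set yx | A (yx.2, yx.1)]].
Proof.
by apply: submod_closedP => /= [|a u v]; [exact: linrel0 | exact: linrelL].
Qed.
Definition lr_converse m n (A : linrel m n) : linrel n m :=
  LinRelation (lr_converse_submod A).

Lemma lr_twisted_orth_submod m n (A : linrel m n) :
  submod_closed [in [set w : 'rV[R]_m * 'rV[R]_n |
    forall x y, A (x, y) -> dotp w.1 x - dotp w.2 y = 0]].
Proof.
apply: submod_closedP => /= [x y _|a u v Hu Hv x y Axy].
  by rewrite /dotp !big1 ?subrr // => i _; rewrite mxE mul0r.
rewrite -[v.1]scale1r -[v.2]scale1r !dotpDl !mul1r opprD addrACA -mulrBr.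
by rewrite Hu // Hv // mulr0 addr0.
Qed.
Definition lr_twisted_orth m n (A : linrel m n) : linrel m n :=
  LinRelation (lr_twisted_orth_submod A).

Definition lr_dual m n (A : linrel m n) : linrel n m :=
  lr_converse (lr_twisted_orth A).

Lemma lr_tensor_submod m n p q (A : linrel m n) (B : linrel p q) :
  submod_closed [in [set uv : 'rV[R]_(m + p) * 'rV[R]_(n + q) |
    A (lsubmx uv.1, lsubmx uv.2) /\ B (rsubmx uv.1, rsubmx uv.2)]].
Proof.
apply: submod_closedP => /= [|a u v [Au Bu] [Av Bv]].
  by rewrite !linear0; split; apply: linrel0.
by rewrite !linearP; split; apply: linrelL.
Qed.
Definition lr_tensor m n p q (A : linrel m n) (B : linrel p q) :
  linrel (m + p) (n + q) := LinRelation (lr_tensor_submod A B).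

Lemma lr_symmetry_submod m n :
  submod_closed [in [set uv : 'rV[R]_(m + n) * 'rV[R]_(n + m) |
    exists x y, uv = (row_mx x y, row_mx y x)]].
Proof.
apply: submod_closedP => /= [|a _ _ [x [y ->]] [x' [y' ->]]].
  by exists 0, 0; rewrite !row_mx0.
exists (a *: x + x'), (a *: y + y').
by congr pair; rewrite /= scale_row_mx add_row_mx.
Qed.
Definition lr_symmetry m n : linrel (m + n) (n + m) :=
  LinRelation (@lr_symmetry_submod m n).

Definition LinRel_monoidal : sym_monoidal LinRel :=
  @SymMonoidal LinRel lr_tensor lr_symmetry.

Lemma lr_full_submod m n :
  submod_closed [in [set: 'rV[R]_m * 'rV[R]_n]].
Proof. exact: submod_closedP. Qed.

Lemma lr_copy_submod n :
  submod_closed [in [set xw : 'rV[R]_n * 'rV[R]_(n + n) |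
    exists x, xw = (x, row_mx x x)]].
Proof.
apply: submod_closedP => /= [|a _ _ [x ->] [y ->]].
  by exists 0; rewrite row_mx0.
by exists (a *: x + y); congr pair; rewrite /= scale_row_mx add_row_mx.
Qed.

Lemma lr_merge_submod n :
  submod_closed [in [set wx : 'rV[R]_(n + n) * 'rV[R]_n |
    exists x, wx = (row_mx x x, x)]].
Proof.
apply: submod_closedP => /= [|a _ _ [x ->] [y ->]].
  by exists 0; rewrite row_mx0.
by exists (a *: x + y); congr pair; rewrite /= scale_row_mx add_row_mx.
Qed.

Definition LinRel_additive : hypergraph_maps LinRel :=
  @HypergraphMaps LinRel
    (fun n => LinRelation (@lr_full_submod 0 n))
    (fun n => LinRelation (@lr_full_submod n 0))
    (fun n => LinRelation (@lr_copy_submod n))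
    (fun n => LinRelation (@lr_merge_submod n)).

Lemma lr_zero_submod m n :
  submod_closed [in [set (0, 0) : 'rV[R]_m * 'rV[R]_n]].
Proof. by apply: submod_closedP => //= a u v -> ->; rewrite scaler0 addr0. Qed.

Lemma lr_add_submod n :
  submod_closed [in [set wz : 'rV[R]_(n + n) * 'rV[R]_n |
    exists x y, wz = (row_mx x y, x + y)]].
Proof.
apply: submod_closedP => /= [|a _ _ [x [y ->]] [x' [y' ->]]].
  by exists 0, 0; rewrite row_mx0 addr0.
exists (a *: x + x'), (a *: y + y').
by congr pair; rewrite /= ?scale_row_mx ?add_row_mx // scalerDr addrACA.
Qed.

Lemma lr_coadd_submod n :
  submod_closed [in [set zw : 'rV[R]_n * 'rV[R]_(n + n) |
    exists x y, zw = (x + y, row_mx x y)]].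
Proof.
apply: submod_closedP => /= [|a _ _ [x [y ->]] [x' [y' ->]]].
  by exists 0, 0; rewrite row_mx0 addr0.
exists (a *: x + x'), (a *: y + y').
by congr pair; rewrite /= ?scale_row_mx ?add_row_mx // scalerDr addrACA.
Qed.

Definition LinRel_coadditive : hypergraph_maps LinRel :=
  @HypergraphMaps LinRel
    (fun n => LinRelation (@lr_zero_submod 0 n))
    (fun n => LinRelation (@lr_zero_submod n 0))
    (fun n => LinRelation (@lr_coadd_submod n))
    (fun n => LinRelation (@lr_add_submod n)).

Definition bifn m n := 'rV[R]_m -> 'rV[R]_n -> \bar R.

Definition epigraph m n (F : bifn m n) : set ('rV[R]_m * 'rV[R]_n * R^o) :=
  [set p | (F p.1.1 p.1.2 <= (p.2)%:E)%E].

Definition convex_bifn m n (F : bifn m n) : Prop := convex_set (epigraph F).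
Definition concave_bifn m n (F : bifn m n) : Prop :=
  convex_bifn (fun x y => - F x y)%E.

Record cxbifn m n := CxBifn {
  cx_fun :> 'rV[R]_m -> 'rV[R]_n -> \bar R;
  cx_convex : convex_bifn cx_fun }.

Record cvbifn m n := CvBifn {
  cv_fun :> 'rV[R]_m -> 'rV[R]_n -> \bar R;
  cv_concave : concave_bifn cv_fun }.

Lemma cxbifn_ext m n (F G : cxbifn m n) : (forall x y, F x y = G x y) -> F = G.
Proof.
case: F G => [F HF] [G HG] /= FG.
have E : F = G by apply/funext => x; apply/funext => y.
by subst G; congr CxBifn; apply: Prop_irrelevance.
Qed.

Lemma cvbifn_ext m n (F G : cvbifn m n) : (forall x y, F x y = G x y) -> F = G.
Proof.
case: F G => [F HF] [G HG] /= FG.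
have E : F = G by apply/funext => x; apply/funext => y.
by subst G; congr CvBifn; apply: Prop_irrelevance.
Qed.

Lemma convex_bifnP m n (F : bifn m n) :
  convex_bifn F <->
  forall x y r x' y' r' (a b : R), 0 <= a -> 0 <= b -> a + b = 1 ->
    (F x y <= r%:E)%E -> (F x' y' <= r'%:E)%E ->
    (F (a *: x + b *: x')%R (a *: y + b *: y')%R <= (a * r + b * r')%:E)%E.
Proof.
split => [cF x y r x' y' r' a b a0 b0 ab Fr Fr'|cF].
  have a1 : a <= 1 by rewrite -ab lerDl.
  have -> : b = 1 - a by rewrite -ab addrC addKr.
  have := cF (x, y, r) (x', y', r') (Itv01 a0 a1).
  by rewrite !inE; apply.
move=> -[[x y] r] [[x' y'] r'] l /[!inE] Fr Fr'.
rewrite /epigraph/=; apply: cF => //; last by rewrite /unstable.onem addrC subrK.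
by rewrite subr_ge0.
Qed.

Definition eindic (P : Prop) : \bar R := if `[< P >] then 0%E else +oo%E.

Lemma eindicT (P : Prop) : P -> eindic P = 0%E.
Proof. by rewrite /eindic; case: asboolP. Qed.

Lemma eindicF (P : Prop) : ~ P -> eindic P = +oo%E.
Proof. by rewrite /eindic; case: asboolP. Qed.

Lemma eindic_le (P : Prop) (r : R) : (eindic P <= r%:E)%E <-> P /\ 0 <= r.
Proof.
rewrite /eindic; case: asboolP => HP; first by rewrite lee_fin; tauto.
by split=> [|[]//]; rewrite leye_eq.
Qed.

Lemma convex_eindic m n (P : 'rV[R]_m -> 'rV[R]_n -> Prop) :
  (forall a b x y x' y', P x y -> P x' y' ->
     P (a *: x + b *: x') (a *: y + b *: y')) ->
  convex_bifn (fun x y => eindic (P x y)).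
Proof.
move=> HP; apply/convex_bifnP => x y r x' y' r' a b a0 b0 _.
move=> /eindic_le[Pxy r0] /eindic_le[Pxy' r0']; apply/eindic_le; split.
  exact: HP.
by rewrite addr_ge0 ?mulr_ge0.
Qed.

Lemma concave_eindic m n (P : 'rV[R]_m -> 'rV[R]_n -> Prop) :
  (forall a b x y x' y', P x y -> P x' y' ->
     P (a *: x + b *: x') (a *: y + b *: y')) ->
  concave_bifn (fun x y => - eindic (P x y))%E.
Proof.
move=> HP; rewrite /concave_bifn.
under [X in convex_bifn X]eq_fun do under eq_fun do rewrite oppeK.
exact: convex_eindic.
Qed.

(** The addition %dE satisfies (+oo) + (-oo) = +oo, and the addition %E
    satisfies (+oo) + (-oo) = -oo. *)

Definition cx_comp_fun m n p (F : bifn n p) (G : bifn m n) : bifn m p :=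
  fun x z => ereal_inf (range (fun y => (G x y + F y z)%dE)).

Definition cv_comp_fun m n p (F : bifn n p) (G : bifn m n) : bifn m p :=
  fun x z => ereal_sup (range (fun y => (G x y + F y z)%E)).

Lemma dadde_le_real (x y : \bar R) (r : R) :
  ((x + y)%dE <= r%:E)%E <->
  exists a b : R, [/\ (x <= a%:E)%E, (y <= b%:E)%E & a + b = r].
Proof.
split => [|[a [b [xa yb <-]]]].
  case: x => [x||]; case: y => [y||] //=; rewrite ?leye_eq // => xy.
  - exists x, (r - x); split => //; last by rewrite addrC subrK.
    by rewrite lee_fin lerBrDl -lee_fin.
  - by exists x, (r - x); split => //; rewrite ?leNye// addrC subrK.
  - by exists (r - y), y; split => //; rewrite ?leNye// subrK.
  - by exists r, 0; split => //; rewrite ?leNye// addr0.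
case: x xa => [x||] //= xa; case: y yb => [y||] //= yb; rewrite ?leNye//.
by rewrite /dual_adde/= lee_fin lerD// -lee_fin.
Qed.

Lemma convex_dadde m n (F G : bifn m n) : convex_bifn F -> convex_bifn G ->
  convex_bifn (fun x y => F x y + G x y)%dE.
Proof.
move=> /convex_bifnP cF /convex_bifnP cG.
apply/convex_bifnP => x y r x' y' r' a b a0 b0 ab.
move=> /dadde_le_real[s [t [Fs Gt <-]]] /dadde_le_real[s' [t' [Fs' Gt' <-]]].
apply/dadde_le_real; exists (a * s + b * s'), (a * t + b * t').
by split; [exact: cF|exact: cG|rewrite !mulrDr addrACA].
Qed.

Lemma inf_range_le (T : Type) (f : T -> \bar R) (r : R) :
  (ereal_inf (range f) <= r%:E)%E <->
  forall e : R, 0 < e -> exists t, (f t <= (r + e)%:E)%E.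
Proof.
split => [fr e e0|H].
  have : (ereal_inf (range f) < (r + e)%:E)%E.
    by rewrite (le_lt_trans fr)// lte_fin ltrDl.
  by move=> /ereal_inf_lt[_ [t _ <-] /ltW ft]; exists t.
apply/lee_addgt0Pr => e /H[t ft]; rewrite -EFinD.
by apply: le_trans ft; apply: ereal_inf_lbound; exists t.
Qed.

Lemma cx_comp_convex m n p (F : cxbifn n p) (G : cxbifn m n) :
  convex_bifn (cx_comp_fun F G).
Proof.
have cF := (convex_bifnP F).1 (@cx_convex _ _ F).
have cG := (convex_bifnP G).1 (@cx_convex _ _ G).
apply/convex_bifnP => x z r x' z' r' a b a0 b0 ab.
move=> /inf_range_le H /inf_range_le H'; apply/inf_range_le => e e0.
have [y /dadde_le_real[s [t [Gs Ft st]]]] := H e e0.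
have [y' /dadde_le_real[s' [t' [Gs' Ft' st']]]] := H' e e0.
exists (a *: y + b *: y'); apply/dadde_le_real.
exists (a * s + b * s'), (a * t + b * t'); split; [exact: cG|exact: cF|].
rewrite addrACA -!mulrDr st st' !mulrDr addrACA.
by rewrite -[a * e + b * e]mulrDl ab mul1r.
Qed.
Definition cx_comp m n p (F : cxbifn n p) (G : cxbifn m n) : cxbifn m p :=
  CxBifn (@cx_comp_convex m n p F G).

Lemma cv_comp_funE m n p (F : bifn n p) (G : bifn m n) x z :
  (- cv_comp_fun F G x z)%E =
  cx_comp_fun (fun y z => - F y z)%E (fun x y => - G x y)%E x z.
Proof.
rewrite /cv_comp_fun /cx_comp_fun -ereal_infN image_comp; congr ereal_inf.
by apply: eq_imagel => y _ /=; rewrite dual_addeE !oppeK.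
Qed.

Lemma cv_comp_concave m n p (F : cvbifn n p) (G : cvbifn m n) :
  concave_bifn (cv_comp_fun F G).
Proof.
rewrite /concave_bifn.
under [X in convex_bifn X]eq_fun do under eq_fun do rewrite cv_comp_funE.
exact: (@cx_comp_convex _ _ _ (CxBifn (@cv_concave _ _ F)) (CxBifn (@cv_concave _ _ G))).
Qed.
Definition cv_comp m n p (F : cvbifn n p) (G : cvbifn m n) : cvbifn m p :=
  CvBifn (@cv_comp_concave m n p F G).

Lemma cx_id_convex n : @convex_bifn n n (fun x y => eindic (x = y)).
Proof. by apply: convex_eindic => a b x y x' y' -> ->. Qed.
Definition cx_id n : cxbifn n n := CxBifn (@cx_id_convex n).

Lemma cv_id_concave n : @concave_bifn n n (fun x y => - eindic (x = y))%E.
Proof. by apply: concave_eindic => a b x y x' y' -> ->. Qed.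
Definition cv_id n : cvbifn n n := CvBifn (@cv_id_concave n).

Lemma daddooe (x : \bar R) : (+oo + x)%dE = +oo%E.
Proof. by case: x. Qed.

Lemma daddeoo (x : \bar R) : (x + +oo)%dE = +oo%E.
Proof. by case: x. Qed.

Lemma inf_range_single (T : Type) (t0 : T) (f : T -> \bar R) :
  (forall t, t <> t0 -> f t = +oo%E) -> ereal_inf (range f) = f t0.
Proof.
move=> H; apply/eqP; rewrite eq_le; apply/andP; split.
  by apply: ereal_inf_lbound; exists t0.
apply: le_ereal_inf_tmp => _ [t _ <-].
by have [->//|/H ->] := pselect (t = t0); rewrite leey.
Qed.

Lemma cx_comp_fun_idl m n (F : bifn m n) x z :
  cx_comp_fun (@cx_id n) F x z = F x z.
Proof.
rewrite /cx_comp_fun (@inf_range_single _ z) => [|y yz].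
  by rewrite /= eindicT// dadde0.
by rewrite /= eindicF// daddeoo.
Qed.

Lemma cx_comp_fun_idr m n (F : bifn m n) x z :
  cx_comp_fun F (@cx_id m) x z = F x z.
Proof.
rewrite /cx_comp_fun (@inf_range_single _ x) => [|y yx].
  by rewrite /= eindicT// dadd0e.
by rewrite /= eindicF ?daddooe// => xy; apply: yx.
Qed.

Lemma dadde_resid (a x y : \bar R) :
  (a <= (x + y)%dE)%E <-> (a - y <= x)%E.
Proof.
case: a => [a||]; case: x => [x||]; case: y => [y||];
  rewrite /dual_adde /adde /= ?leey ?leNye ?leye_eq ?leeNy_eq //=.
by rewrite !lee_fin lerBlDr.
Qed.

Lemma dadde_infl (T : Type) (f : T -> \bar R) (y : \bar R) :
  (ereal_inf (range f) + y)%dE = ereal_inf (range (fun t => (f t + y)%dE)).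
Proof.
apply/eqP; rewrite eq_le; apply/andP; split.
  apply: le_ereal_inf_tmp => _ [t _ <-]; apply/dadde_resid.
  apply: le_trans (_ : ereal_inf (range f) <= _)%E; first exact/dadde_resid.
  by apply: ereal_inf_lbound; exists t.
apply/dadde_resid/le_ereal_inf_tmp => _ [t _ <-]; apply/dadde_resid.
by apply: ereal_inf_lbound; exists t.
Qed.

Lemma dadde_infr (T : Type) (f : T -> \bar R) (y : \bar R) :
  (y + ereal_inf (range f))%dE = ereal_inf (range (fun t => (y + f t)%dE)).
Proof.
rewrite daddeC dadde_infl; congr ereal_inf.
by apply: eq_imagel => t _; rewrite daddeC.
Qed.

Lemma inf_range_exchange (T U : Type) (f : T -> U -> \bar R) :
  ereal_inf (range (fun t => ereal_inf (range (f t)))) =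
  ereal_inf (range (fun u => ereal_inf (range (f ^~ u)))).
Proof.
apply/eqP; rewrite eq_le; apply/andP; split.
  apply: le_ereal_inf_tmp => _ [u _ <-]; apply: le_ereal_inf_tmp => _ [t _ <-].
  apply: (@le_trans _ _ (ereal_inf (range (f t)))).
    by apply: ereal_inf_lbound; exists t.
  by apply: ereal_inf_lbound; exists u.
apply: le_ereal_inf_tmp => _ [t _ <-]; apply: le_ereal_inf_tmp => _ [u _ <-].
apply: (@le_trans _ _ (ereal_inf (range (f ^~ u)))).
  by apply: ereal_inf_lbound; exists u.
by apply: ereal_inf_lbound; exists t.
Qed.

Lemma cx_comp_funA m n p q (H : bifn p q) (G : bifn n p) (F : bifn m n) x z :
  cx_comp_fun H (cx_comp_fun G F) x z = cx_comp_fun (cx_comp_fun H G) F x z.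
Proof.
rewrite /cx_comp_fun.
under eq_fun do rewrite dadde_infl.
under [in RHS]eq_fun do rewrite dadde_infr.
rewrite inf_range_exchange; congr ereal_inf; apply: eq_imagel => y _.
by congr ereal_inf; apply: eq_imagel => w _; rewrite daddeA.
Qed.

Lemma cx_comp_idl m n (F : cxbifn m n) : cx_comp (cx_id n) F = F.
Proof. by apply: cxbifn_ext => x z; apply: cx_comp_fun_idl. Qed.

Lemma cx_comp_idr m n (F : cxbifn m n) : cx_comp F (cx_id m) = F.
Proof. by apply: cxbifn_ext => x z; apply: cx_comp_fun_idr. Qed.

Lemma cx_compA m n p q (H : cxbifn p q) (G : cxbifn n p) (F : cxbifn m n) :
  cx_comp H (cx_comp G F) = cx_comp (cx_comp H G) F.
Proof. by apply: cxbifn_ext => x z; apply: cx_comp_funA. Qed.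

Definition CxBiFn : category := Category cx_comp_idl cx_comp_idr cx_compA.

Lemma cv_comp_idl m n (F : cvbifn m n) : cv_comp (cv_id n) F = F.
Proof.
apply: cvbifn_ext => x z; apply: oppe_inj; rewrite /= cv_comp_funE.
rewrite -[RHS](cx_comp_fun_idl (fun x y => - F x y)%E).
by congr (cx_comp_fun _ _ x z); apply/funext=> u; apply/funext=> v /=; rewrite oppeK.
Qed.

Lemma cv_comp_idr m n (F : cvbifn m n) : cv_comp F (cv_id m) = F.
Proof.
apply: cvbifn_ext => x z; apply: oppe_inj; rewrite /= cv_comp_funE.
rewrite -[RHS](cx_comp_fun_idr (fun x y => - F x y)%E).
by congr (cx_comp_fun _ _ x z); apply/funext=> u; apply/funext=> v /=; rewrite oppeK.
Qed.

Lemma cv_compA m n p q (H : cvbifn p q) (G : cvbifn n p) (F : cvbifn m n) :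
  cv_comp H (cv_comp G F) = cv_comp (cv_comp H G) F.
Proof.
apply: cvbifn_ext => x z; apply: oppe_inj; rewrite /= !cv_comp_funE.
have E m' n' p' (A : bifn n' p') (B : bifn m' n') :
    (fun x z => - cv_comp_fun A B x z)%E =
    cx_comp_fun (fun y z => - A y z)%E (fun x y => - B x y)%E.
  by apply/funext => u; apply/funext => v; apply: cv_comp_funE.
by rewrite !E; apply: cx_comp_funA.
Qed.

Definition CvBiFn : category := Category cv_comp_idl cv_comp_idr cv_compA.

Definition cx_adj_fun m n (F : bifn m n) : bifn n m := fun ystar xstar =>
  ereal_inf (range (fun xy : 'rV[R]_m * 'rV[R]_n =>
    F xy.1 xy.2 + (dotp xstar xy.1)%:E - (dotp ystar xy.2)%:E))%E.

Definition cv_adj_fun m n (F : bifn m n) : bifn n m := fun ystar xstar =>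
  ereal_sup (range (fun xy : 'rV[R]_m * 'rV[R]_n =>
    F xy.1 xy.2 + (dotp xstar xy.1)%:E - (dotp ystar xy.2)%:E))%E.

Lemma cv_adj_convex m n (F : bifn m n) : convex_bifn (cv_adj_fun F).
Proof.
apply/convex_bifnP => y x r y' x' r' a b a0 b0 ab Hr Hr'.
apply: ge_ereal_sup => _ [[u v] _ <-] /=.
have {Hr} : (F u v + (dotp x u)%:E - (dotp y v)%:E <= r%:E)%E.
  by apply: le_trans Hr; apply: ereal_sup_ubound; exists (u, v).
have {Hr'} : (F u v + (dotp x' u)%:E - (dotp y' v)%:E <= r'%:E)%E.
  by apply: le_trans Hr'; apply: ereal_sup_ubound; exists (u, v).
case: (F u v) => [f||] /=; rewrite ?leye_eq ?leNye //.
rewrite -!EFinD !lee_fin => H' H.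
rewrite !dotpDl -[f]mul1r -ab mulrDl.
apply: le_trans (lerD (ler_wpM2l a0 H) (ler_wpM2l b0 H')).
lra.
Qed.

Lemma cx_adj_funE m n (F : bifn m n) y x :
  (- cx_adj_fun F y x)%E = cv_adj_fun (fun x y => - F x y)%E (- y) (- x).
Proof.
rewrite /cx_adj_fun /cv_adj_fun -ereal_supN image_comp; congr ereal_sup.
apply: eq_imagel => -[u v] _ /=.
have dN k (s t : 'rV[R]_k) : dotp (- s) t = - dotp s t.
  by rewrite /dotp -sumrN; apply: eq_bigr => i _; rewrite mxE mulNr.
by case: (F u v) => [f||] //=; rewrite !dN -?EFinD -?EFinN ?opprD.
Qed.

Lemma cx_adj_concave m n (F : bifn m n) : concave_bifn (cx_adj_fun F).
Proof.
have /convex_bifnP H := @cv_adj_convex _ _ (fun x y => - F x y)%E.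
apply/convex_bifnP => y x r y' x' r' a b a0 b0 ab; rewrite !cx_adj_funE.
by rewrite !opprD -!scalerN; apply: H.
Qed.

Definition cx_adj m n (F : cxbifn m n) : cvbifn n m :=
  CvBifn (@cx_adj_concave m n F).
Definition cv_adj m n (F : cvbifn m n) : cxbifn n m :=
  CxBifn (@cv_adj_convex m n F).

Lemma cx_tensor_convex m n p q (F : cxbifn m n) (G : cxbifn p q) :
  convex_bifn (fun (u : 'rV[R]_(m + p)) (v : 'rV[R]_(n + q)) =>
    F (lsubmx u) (lsubmx v) + G (rsubmx u) (rsubmx v))%dE.
Proof.
apply: convex_dadde; apply/convex_bifnP => x y r x' y' r' a b a0 b0 ab;
  rewrite !linearD !linearZ.
- by apply: ((convex_bifnP F).1 (@cx_convex _ _ F)).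
- by apply: ((convex_bifnP G).1 (@cx_convex _ _ G)).
Qed.
Definition cx_tensor m n p q (F : cxbifn m n) (G : cxbifn p q) :
  cxbifn (m + p) (n + q) := CxBifn (@cx_tensor_convex m n p q F G).

Lemma cx_symmetry_convex m n :
  convex_bifn (fun (u : 'rV[R]_(m + n)) (v : 'rV[R]_(n + m)) =>
    eindic (lsubmx u = rsubmx v /\ rsubmx u = lsubmx v)).
Proof.
apply: convex_eindic => a b x y x' y' [xy1 xy2] [xy1' xy2'].
by rewrite !linearD !linearZ /= xy1 xy2 xy1' xy2'.
Qed.
Definition cx_symmetry m n : cxbifn (m + n) (n + m) :=
  CxBifn (@cx_symmetry_convex m n).

Definition CxBiFn_monoidal : sym_monoidal CxBiFn :=
  @SymMonoidal CxBiFn cx_tensor cx_symmetry.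

Lemma cx_cst0_convex m n : @convex_bifn m n (fun _ _ => 0%E).
Proof.
apply/convex_bifnP => x y r x' y' r' a b a0 b0 ab; rewrite !lee_fin => r0 r0'.
by rewrite addr_ge0 ?mulr_ge0.
Qed.

Lemma cx_copy_convex n :
  convex_bifn (fun (x : 'rV[R]_n) (w : 'rV[R]_(n + n)) =>
    eindic (x = lsubmx w /\ lsubmx w = rsubmx w)).
Proof.
apply: convex_eindic => a b x y x' y' [xy1 xy2] [xy1' xy2'].
by rewrite !linearD !linearZ /= xy1 xy2 xy1' xy2'.
Qed.

Lemma cx_merge_convex n :
  convex_bifn (fun (w : 'rV[R]_(n + n)) (z : 'rV[R]_n) =>
    eindic (lsubmx w = rsubmx w /\ rsubmx w = z)).
Proof.
apply: convex_eindic => a b x y x' y' [xy1 xy2] [xy1' xy2'].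
by rewrite !linearD !linearZ /= xy1 xy2 xy1' xy2'.
Qed.

Definition CxBiFn_additive : hypergraph_maps CxBiFn :=
  @HypergraphMaps CxBiFn
    (fun n => CxBifn (@cx_cst0_convex 0 n))
    (fun n => CxBifn (@cx_cst0_convex n 0))
    (fun n => CxBifn (@cx_copy_convex n))
    (fun n => CxBifn (@cx_merge_convex n)).

Lemma cx_zero_convex n :
  convex_bifn (fun (_ : 'rV[R]_0) (x : 'rV[R]_n) => eindic (x = 0)).
Proof.
by apply: convex_eindic => a b x y x' y' -> ->; rewrite !scaler0 addr0.
Qed.

Lemma cx_cozero_convex n :
  convex_bifn (fun (x : 'rV[R]_n) (_ : 'rV[R]_0) => eindic (x = 0)).
Proof.
by apply: convex_eindic => a b x y x' y' -> ->; rewrite !scaler0 addr0.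
Qed.

Lemma cx_add_convex n :
  convex_bifn (fun (w : 'rV[R]_(n + n)) (z : 'rV[R]_n) =>
    eindic (lsubmx w + rsubmx w = z)).
Proof.
apply: convex_eindic => a b x y x' y' <- <-.
by rewrite !linearD !linearZ /= addrACA.
Qed.

Lemma cx_coadd_convex n :
  convex_bifn (fun (z : 'rV[R]_n) (w : 'rV[R]_(n + n)) =>
    eindic (lsubmx w + rsubmx w = z)).
Proof.
apply: convex_eindic => a b x y x' y' <- <-.
by rewrite !linearD !linearZ /= addrACA.
Qed.

Definition CxBiFn_coadditive : hypergraph_maps CxBiFn :=
  @HypergraphMaps CxBiFn
    (fun n => CxBifn (@cx_zero_convex n))
    (fun n => CxBifn (@cx_cozero_convex n))
    (fun n => CxBifn (@cx_coadd_convex n))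
    (fun n => CxBifn (@cx_add_convex n)).

Lemma lr_ind_convex m n (A : linrel m n) :
  convex_bifn (fun x y => eindic (A (x, y))).
Proof. by apply: convex_eindic => *; apply: linrelLL. Qed.
Definition lr_ind m n (A : linrel m n) : cxbifn m n := CxBifn (@lr_ind_convex m n A).

Lemma lr_neg_ind_concave m n (A : linrel m n) :
  concave_bifn (fun x y => - eindic (A (x, y)))%E.
Proof. by apply: concave_eindic => *; apply: linrelLL. Qed.
Definition lr_neg_ind m n (A : linrel m n) : cvbifn m n :=
  CvBifn (@lr_neg_ind_concave m n A).

End Spaces.

(* Main.v *)
Require Import Defs.
From HB Require Import structures.
From mathcomp Require Import all_boot all_order all_algebra.
From mathcomp Require Import all_classical all_reals all_analysis.

(** Two properties of indicators carry the functoriality: adding two of them is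
    conjunction, and taking their infimum over a parameter is existential
    quantification ([eindic_dadd], [inf_eindic]). So the composition and tensor
    of convex bifunctions, restricted to indicators, become relational
    composition and product, and [lr_ind] is a monoidal functor; the concave
    statement follows by negation. Each hypergraph structure map on the convex
    side is the indicator of the corresponding linear relation.

    For the duality, the concave adjoint of minus the indicator of A, at
    (y', x'), is the supremum over A of the linear functional
    (x, y) |-> <x', x> - <y', y>. A linear functional on a subspace either
    vanishes there, with supremum 0, or is onto the reals, with supremum +oo
    ([cv_adj_neg_ind]); vanishing on A is membership of (y', x') in the dual
    relation. The convex adjoint reduces to the concave one because negating
    the values and the arguments exchanges them, and a subspace is closed under
    negation. *)

Import Order.TTheory GRing.Theory Num.Theory.
Import constructive_ereal.DualAddTheoryNumDomain.
Local Open Scope classical_set_scope.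
Local Open Scope ring_scope.

Section IndicatorFunctor.
Set Implicit Arguments.
Unset Strict Implicit.
Variable R : realType.
Implicit Types m n p q : nat.

Lemma eq_eindic (P Q : Prop) : (P <-> Q) -> eindic R P = eindic R Q.
Proof. by move=> PQ; congr eindic; apply/propext. Qed.

Lemma eindic_dadd (P Q : Prop) :
  (eindic R P + eindic R Q)%dE = eindic R (P /\ Q).
Proof.
have [HP|HP] := pselect P; last first.
  by rewrite (eindicF _ HP) daddooe eindicF// => -[].
have [HQ|HQ] := pselect Q; last first.
  by rewrite (eindicF _ HQ) daddeoo eindicF// => -[].
by rewrite !eindicT// dadd0e.
Qed.

Lemma inf_eindic (T : Type) (P : T -> Prop) :
  ereal_inf (range (fun t => eindic R (P t))) = eindic R (exists t, P t).
Proof.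
apply/eqP; rewrite eq_le; apply/andP; split.
  have [HP|HP] := pselect (exists t, P t); last by rewrite (eindicF _ HP) leey.
  case: (HP) => t Pt; rewrite (eindicT _ HP) -(eindicT R Pt).
  by apply: ereal_inf_lbound; exists t.
apply: le_ereal_inf_tmp => _ [t _ <-].
have [Pt|nPt] := pselect (P t); last by rewrite (eindicF _ nPt) leey.
by rewrite !eindicT//; exists t.
Qed.

(** On indicators, the composition of convex bifunctions is relational
    composition. *)
Lemma cx_comp_fun_eindic m n p (P : 'rV[R]_n -> 'rV[R]_p -> Prop)
    (Q : 'rV[R]_m -> 'rV[R]_n -> Prop) x z :
  cx_comp_fun (fun y z => eindic R (P y z)) (fun x y => eindic R (Q x y)) x z =
  eindic R (exists y, Q x y /\ P y z).
Proof.
by rewrite /cx_comp_fun; under eq_fun do rewrite eindic_dadd; exact: inf_eindic.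
Qed.

Lemma cv_comp_fun_eindic m n p (P : 'rV[R]_n -> 'rV[R]_p -> Prop)
    (Q : 'rV[R]_m -> 'rV[R]_n -> Prop) x z :
  cv_comp_fun (fun y z => - eindic R (P y z))%E
    (fun x y => - eindic R (Q x y))%E x z =
  (- eindic R (exists y, Q x y /\ P y z))%E.
Proof.
apply: oppe_inj; rewrite cv_comp_funE oppeK -cx_comp_fun_eindic.
by congr (cx_comp_fun _ _ x z); apply/funext => u; apply/funext => v;
  rewrite oppeK.
Qed.

Lemma lr_ind_functor :
  @is_functor (LinRel R) (CxBiFn R) (fun m n A => lr_ind A).
Proof.
split=> [n|m n p g f]; first by apply: cxbifn_ext => x y.
apply: cxbifn_ext => x z /=; rewrite /cx_comp /=.
by rewrite (cx_comp_fun_eindic (fun y z => g (y, z)) (fun x y => f (x, y))).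
Qed.

Lemma lr_neg_ind_functor :
  @is_functor (opposite (LinRel R)) (opposite (CvBiFn R))
    (fun m n A => lr_neg_ind A).
Proof.
split=> [n|m n p g f]; first by apply: cvbifn_ext => x y.
apply: cvbifn_ext => x z /=.
by rewrite (cv_comp_fun_eindic (fun y z => f (y, z)) (fun x y => g (x, y))).
Qed.

Lemma dotpZr n (a : R) (x u : 'rV[R]_n) : dotp x (a *: u) = a * dotp x u.
Proof. by rewrite -[a *: u]addr0 -(scale0r u) dotpDr mul0r addr0. Qed.

Lemma linrelZ m n (A : linrel R m n) a x y :
  A (x, y) -> A (a *: x, a *: y).
Proof.
by move=> Axy; rewrite -[a *: x]addr0 -[a *: y]addr0;
  apply: linrelL => //; exact: linrel0.
Qed.

Lemma linrelN m n (A : linrel R m n) x y : A (- x, - y) <-> A (x, y).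
Proof.
have AN u v : A (u, v) -> A (- u, - v).
  by move=> /(@linrelZ _ _ _ (-1)); rewrite !scaleN1r.
by split=> [/AN|/AN//]; rewrite !opprK.
Qed.

(** The support function of a subspace is the indicator of its orthogonal
    complement, here twisted by the sign in <x', x> - <y', y>. *)
Lemma cv_adj_neg_ind m n (A : linrel R m n) y x :
  cv_adj_fun (fun x y => - eindic R (A (x, y)))%E y x =
  eindic R (lr_dual A (y, x)).
Proof.
have val u v : A (u, v) ->
    (- eindic R (A (u, v)) + (dotp x u)%:E - (dotp y v)%:E)%E =
    (dotp x u - dotp y v)%:E.
  by move=> Auv; rewrite eindicT// oppe0 add0e.
have [D|D] := pselect (lr_dual A (y, x)).
  have D0 u v : A (u, v) -> dotp x u - dotp y v = 0 by exact: D.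
  rewrite (eindicT _ D); apply/eqP; rewrite eq_le; apply/andP; split.
    apply: ge_ereal_sup => _ [[u v] _ <-] /=.
    have [Auv|nAuv] := pselect (A (u, v)); last first.
      by rewrite eindicF// !addNye leNye.
    by rewrite val// D0.
  apply: ereal_sup_ubound; exists (0, 0) => //=.
  by rewrite val ?D0//; exact: linrel0.
rewrite (eindicF _ D).
have [u [v [Auv c0]]] :
    exists u v, A (u, v) /\ dotp x u - dotp y v != 0.
  apply: contrapT => H; apply: D => u v Auv /=.
  by apply/eqP; apply: contrapT => /negP c0; apply: H; exists u, v.
apply/eqyP => r _; apply: ereal_sup_ubound.
(* rescaling a point where the functional is non-zero attains the value r *)
set c := dotp x u - dotp y v in c0; exists (r / c *: u, r / c *: v) => //=.
by rewrite val; [rewrite !dotpZr -mulrBr divfK|exact: linrelZ].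
Qed.

Lemma lr_ind_dual m n (A : linrel R m n) :
  cx_adj (lr_ind A) = lr_neg_ind (lr_dual A).
Proof.
apply: cvbifn_ext => y x; apply: oppe_inj; rewrite /= cx_adj_funE oppeK.
by rewrite cv_adj_neg_ind; apply: eq_eindic; exact: linrelN.
Qed.

Lemma lr_neg_ind_dual m n (A : linrel R m n) :
  cv_adj (lr_neg_ind A) = lr_ind (lr_dual A).
Proof. by apply: cxbifn_ext => y x; exact: cv_adj_neg_ind. Qed.

Lemma lr_ind_monoidal :
  @is_sym_monoidal_functor (LinRel R) (CxBiFn R)
    (LinRel_monoidal R) (CxBiFn_monoidal R) (fun m n A => lr_ind A).
Proof.
split=> [|m n p q f g|m n]; first exact: lr_ind_functor.
  by apply: cxbifn_ext => u v /=; rewrite eindic_dadd.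
apply: cxbifn_ext => u v; apply: eq_eindic; split=> [[x [y [-> ->]]]|[uv vu]].
  by rewrite !row_mxKl !row_mxKr.
by exists (lsubmx u), (rsubmx u); rewrite hsubmxK uv vu hsubmxK.
Qed.

Lemma lr_ind_additive :
  @preserves_hypergraph (LinRel R) (CxBiFn R)
    (LinRel_monoidal R) (CxBiFn_monoidal R)
    (LinRel_additive R) (CxBiFn_additive R) (fun m n A => lr_ind A).
Proof.
split=> [|n]; first exact: lr_ind_monoidal.
split; apply: cxbifn_ext => u v /=; try exact: eindicT; apply: eq_eindic.
  split=> [[x [-> ->]]|[-> E]]; first by rewrite row_mxKl row_mxKr.
  by exists (lsubmx v); rewrite {4}E hsubmxK.
split=> [[x [-> ->]]|[E <-]]; first by rewrite row_mxKl row_mxKr.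
by exists (rsubmx u); rewrite -{2}E hsubmxK.
Qed.

Lemma lr_ind_coadditive :
  @preserves_hypergraph (LinRel R) (CxBiFn R)
    (LinRel_monoidal R) (CxBiFn_monoidal R)
    (LinRel_coadditive R) (CxBiFn_coadditive R) (fun m n A => lr_ind A).
Proof.
split=> [|n]; first exact: lr_ind_monoidal.
split; apply: cxbifn_ext => u v /=; apply: eq_eindic.
- by split=> [[_ ->]|->] //; rewrite (thinmx0 u).
- by split=> [[-> _]|->] //; rewrite (thinmx0 v).
- split=> [[x [y [-> ->]]]|<-]; first by rewrite row_mxKl row_mxKr.
  by exists (lsubmx v), (rsubmx v); rewrite hsubmxK.
- split=> [[x [y [-> ->]]]|<-]; first by rewrite row_mxKl row_mxKr.
  by exists (lsubmx u), (rsubmx u); rewrite hsubmxK.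
Qed.

End IndicatorFunctor.

Theorem theorem4 (R : realType) :
  [/\ @is_functor (LinRel R) (CxBiFn R) (fun m n A => lr_ind A),
      @is_functor (opposite (LinRel R)) (opposite (CvBiFn R))
        (fun m n A => lr_neg_ind A),
      forall (m n : nat) (A : linrel R m n),
        cx_adj (lr_ind A) = lr_neg_ind (lr_dual A) /\
        cv_adj (lr_neg_ind A) = lr_ind (lr_dual A),
      @preserves_hypergraph (LinRel R) (CxBiFn R)
        (LinRel_monoidal R) (CxBiFn_monoidal R)
        (LinRel_additive R) (CxBiFn_additive R) (fun m n A => lr_ind A)
    & @preserves_hypergraph (LinRel R) (CxBiFn R)
        (LinRel_monoidal R) (CxBiFn_monoidal R)
        (LinRel_coadditive R) (CxBiFn_coadditive R) (fun m n A => lr_ind A)].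
Proof.
split.
- exact: lr_ind_functor.
- exact: lr_neg_ind_functor.
- by move=> m n A; split; [exact: lr_ind_dual|exact: lr_neg_ind_dual].
- exact: lr_ind_additive.
- exact: lr_ind_coadditive.
Qed.
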